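(* Let $\mathcal{A}$ be a $\sigma$-field of subsets of a nonempty set $X$. Then the factor ring $\mathcal{M}(X,\mathcal{A})/\operatorname{Soc}(\mathcal{M}(X,\mathcal{A}))$ is self-injective if and only if $\mathcal{A}$ is complete (as a Boolean algebra), $\mathfrak{c}^+$-additive, and has only finitely many atoms.
   Context: A $\sigma$-field of subsets of $X$ is a nonempty family $\mathcal{A}\subseteq\mathcal{P}(X)$ closed under complements in $X$ and countable unions; it is a Boolean algebra under the set operations. $\mathcal{M}(X,\mathcal{A})=\{f:X\to\mathbb{R} : f^{-1}(U)\in\mathcal{A}\text{ for every open }U\subseteq\mathbb{R}\}$, a commutative ring under pointwise operations. For a commutative ring $R$ with identity, the socle $\operatorname{Soc}(R)$ is the sum of all nonzero minimal ideals of $R$ (it is $0$ if there are none). $R$ is self-injective if for every ideal $I$ of $R$, every $R$-module homomorphism $I\to R$ extends to an $R$-module homomorphism $R\to R$. A Boolean algebra is complete if every nonempty subset has a supremum in it (for a field of sets, this supremum need not be the union). Let $\mathfrak{c}=2^{\aleph_0}$; $\mathcal{A}$ is $\mathfrak{c}^+$-additive if $\bigcup_{i\in I}A_i\in\mathcal{A}$ for every family $\{A_i:i\in I\}$ in $\mathcal{A}$ with $|I|\le\mathfrak{c}$. An atom of $\mathcal{A}$ is a nonempty $A\in\mathcal{A}$ such that every nonempty $C\in\mathcal{A}$ with $C\subseteq A$ equals $A$. *)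

(* Defs.v *)
From HB Require Import structures.
From mathcomp Require Import all_boot all_order all_algebra.
From mathcomp Require Import all_classical all_reals all_analysis.
From mathcomp Require Import measurable_realfun.

Set Implicit Arguments.
Unset Strict Implicit.
Unset Printing Implicit Defensive.

Import Order.TTheory GRing.Theory Num.Theory.
Import numFieldNormedType.Exports.
Local Open Scope classical_set_scope.
Local Open Scope ring_scope.
Local Open Scope quotient_scope.

(* Rings are [comPzRingType]s, so that the zero ring is allowed: the quotient
   of a ring by its socle can be trivial. Ideals of [R] are the submodules of
   the regular module [R^o]; they are allowed to be improper. *)
Notation ideal R := (submodClosed R^o).

Section IdealModule.
Variables (R : comPzRingType) (I : ideal R).

Record ideal_module := IdealModule {
  ideal_val : R^o;
  ideal_valP : ideal_val \in (I : {pred R^o}) }.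

HB.instance Definition _ := [isSub for ideal_val].
HB.instance Definition _ := [Choice of ideal_module by <:].
HB.instance Definition _ := [SubChoice_isSubLmodule of ideal_module by <:].

End IdealModule.

Definition self_injective (R : comPzRingType) : Prop :=
  forall (I : ideal R) (f : {linear ideal_module I -> R^o}),
    exists g : {linear R^o -> R^o}, forall x : ideal_module I, g (val x) = f x.

Section IdealQuotient.
Variables (R : comPzRingType) (I : ideal R).

Definition ideal_pred : {pred R} := fun x => x \in I.

Lemma ideal_pred_zmod_closed : zmod_closed ideal_pred.
Proof.
have [I0 IZ] := submodClosedP I; split=> [|x y Ix Iy]; first exact: I0.
by have := IZ (-1) y x Iy Ix; rewrite scaleN1r addrC.
Qed.

HB.instance Definition _ :=
  GRing.isZmodClosed.Build R ideal_pred ideal_pred_zmod_closed.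

Lemma ideal_predM (x y : R) : y \in ideal_pred -> x * y \in ideal_pred.
Proof. by move=> Iy; apply: (@rpredZ R R^o I x y). Qed.

(* [Quotient.quot] only carries a ring structure for proper ideals of nonzero
   rings; the ring structure below is for arbitrary ideals. *)
Definition ideal_quotient := Quotient.quot ideal_pred.
Local Notation Q := ideal_quotient.

HB.instance Definition _ := GRing.Zmodule.on ideal_quotient.
HB.instance Definition _ := Quotient.on ideal_quotient.

Definition quotient_one : Q := \pi_Q 1.
Definition quotient_mul : Q -> Q -> Q := lift_op2 Q *%R.

Lemma ideal_quotient_piP (x y : R) : (\pi_Q x = \pi_Q y) <-> x - y \in I.
Proof.
by split=> [/eqP|xy]; [|apply/eqP]; rewrite -Quotient.idealrBE.
Qed.

Lemma quotient_mul_pi (x y : R) :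
  quotient_mul (\pi_Q x) (\pi_Q y) = \pi_Q (x * y).
Proof.
rewrite /quotient_mul; unlock; apply/ideal_quotient_piP.
set x' := repr _; set y' := repr _.
have Hx : x' - x \in ideal_pred by apply/ideal_quotient_piP; rewrite reprK.
have Hy : y' - y \in ideal_pred by apply/ideal_quotient_piP; rewrite reprK.
have -> : x' * y' - x * y = y' * (x' - x) + x * (y' - y).
  by rewrite !mulrBr addrA [y' * x']mulrC [y' * x]mulrC subrK.
by apply: (@rpredD _ ideal_pred); apply: ideal_predM.
Qed.

Lemma quotient_mulA : associative quotient_mul.
Proof.
move=> x y z; rewrite -[x]reprK -[y]reprK -[z]reprK.
by rewrite !quotient_mul_pi mulrA.
Qed.

Lemma quotient_mulC : commutative quotient_mul.
Proof.
by move=> x y; rewrite -[x]reprK -[y]reprK !quotient_mul_pi mulrC.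
Qed.

Lemma quotient_mul1 : left_id quotient_one quotient_mul.
Proof. by move=> x; rewrite -[x]reprK quotient_mul_pi mul1r. Qed.

Lemma quotient_mulDl : left_distributive quotient_mul +%R.
Proof.
move=> x y z; rewrite -[x]reprK -[y]reprK -[z]reprK.
have piD (a b : R) : \pi_Q a + \pi_Q b = \pi_Q (a + b).
  by rewrite [RHS]Quotient.pi_add.
by rewrite piD !quotient_mul_pi piD mulrDl.
Qed.

HB.instance Definition _ := GRing.Zmodule_isComPzRing.Build ideal_quotient
  quotient_mulA quotient_mulC quotient_mul1 quotient_mulDl.

End IdealQuotient.

Section Socle.
Variable R : comPzRingType.

Definition nonzero_ideal (I : ideal R) : Prop := exists2 x, x \in I & x != 0.

Definition minimal_ideal (I : ideal R) : Prop :=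
  nonzero_ideal I /\
  forall J : ideal R, nonzero_ideal J -> {subset J <= I} -> J =i I.

(* The sum of a family of ideals: finite sums of elements of its members. *)
Definition socle : {pred R^o} := fun x =>
  `[< exists2 s : seq R^o,
        forall y, y \in s -> exists2 I : ideal R, minimal_ideal I & y \in I
      & x = \sum_(y <- s) y >].

Lemma socle_submod_closed : submod_closed socle.
Proof.
split=> [|a x y /asboolP[s sP ->] /asboolP[t tP ->]]; apply/asboolP.
  by exists [::]; rewrite ?big_nil.
exists ([seq a *: z | z <- s] ++ t); last first.
  by rewrite big_cat big_map scaler_sumr.
move=> z; rewrite mem_cat => /orP[/mapP[w ws ->]|/tP//].
by have [I mI Iw] := sP w ws; exists I => //; apply: rpredZ.
Qed.

HB.instance Definition _ :=
  GRing.isSubmodClosed.Build R R^o socle socle_submod_closed.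

End Socle.
Arguments socle R : clear implicits.

(* [{mfun X >-> R}] is the ring of functions [f] such that [f @^-1` U] is
   measurable for all Borel sets [U], or equivalently for all open [U]. *)
Lemma measurable_fun_openP (R : realType) (d : measure_display)
    (X : measurableType d) (f : X -> R) :
  measurable_fun setT f <-> forall U : set R, open U -> measurable (f @^-1` U).
Proof.
split=> [mf U oU|fU].
  by rewrite -[Y in measurable Y]setTI; apply: mf => //; exact: open_measurable.
apply: (measurability _ (RGenOpens.measurableE R)).
move=> _ [_ [a [b ->] <-]]; rewrite setTI; apply: fU; exact: interval_open.
Qed.

Section FieldOfSets.
Variables (X : Type) (A : set (set X)).

Definition complete_field : Prop :=
  forall F : set (set X), F `<=` A -> F !=set0 ->
    exists S, [/\ A S, (forall B, F B -> B `<=` S)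
      & forall T, A T -> (forall B, F B -> B `<=` T) -> S `<=` T].

(* The cardinal of the continuum is represented by the powerset of [nat]. *)
Definition continuum_succ_additive : Prop :=
  forall (I : Type) (B : I -> set X), ([set: I] #<= [set: set nat])%card ->
    (forall i, A (B i)) -> A (\bigcup_i B i).

Definition field_atom (B : set X) : Prop :=
  [/\ A B, B !=set0 & forall C, A C -> C !=set0 -> C `<=` B -> C = B].

End FieldOfSets.

(* Main.v *)
Require Import Defs.
From HB Require Import structures.
From mathcomp Require Import all_boot all_order all_algebra.
From mathcomp Require Import all_classical all_reals all_analysis.
From mathcomp Require Import measurable_realfun.
From mathcomp Require wochoice.
Import Order.TTheory GRing.Theory Num.Theory.
Import numFieldNormedType.Exports.
Local Open Scope classical_set_scope.
Local Open Scope ring_scope.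
Set Implicit Arguments.
Unset Strict Implicit.
Unset Printing Implicit Defensive.

(** Write M for the ring of measurable functions and call the set where [f]
    does not vanish the cozero set of [f]. Every function in M has a measurable
    quasi-inverse, so a minimal ideal of M is generated by the indicator of an
    atom, and the socle consists of the functions whose cozero set lies in a
    finite union of atoms ([socle_cozeroP]). Two functions therefore agree in
    Q = M / Soc(M) exactly when they differ only on finitely many atoms
    ([projP]).

    For a self-injective ring, [self_injective_glue] turns extension of
    homomorphisms into a gluing principle: prescribed values [y i] on a family
    [e i] can be realized as [y i = h * e i] as soon as each [y i] lives under
    [e i] and the prescriptions agree on overlaps. The two necessary conditions
    come from two choices of such data in Q.

    - If there were infinitely many atoms, an almost disjoint family of subsets
      of a sequence of atoms would give pairwise orthogonal idempotents
      indexed by the functions [nat -> bool]. The values 0 or 1 prescribed on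
      them can be chosen by diagonalization so that no function realizes all
      of them modulo finitely many atoms.
    - Once there are finitely many atoms, prescribing 1 on the members of a
      family F of measurable sets and 0 on the measurable sets disjoint from
      all of F yields a function whose level set at 1 is, up to atoms, the
      supremum of F.

    Completeness implies additivity up to the continuum. For a disjoint
    family [D i] indexed injectively by sets of naturals, the suprema [G n] of
    the [D i] with [n] in the code of [i] separate the members. A point [x] of
    the supremum determines the set of all points of the supremum that lie in
    the same [G n] as [x]. This set is measurable, as only countably many
    conditions are involved, so it meets some [D i], only one, and hence it is
    contained in that [D i]. An arbitrary family is made disjoint along a
    well-order.

    Conversely, if the field is complete and has finitely many atoms, Q is the
    ring of measurable functions on the complement of the atoms. A homomorphism
    from an ideal of Q is determined by its values on the indicators in the
    ideal. Representatives of these values agree on overlaps, and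
    [complete_glue] glues them into one function, by which the homomorphism is
    multiplication. *)

(** * Gluing in self-injective rings *)

Section GeneratedIdeal.
Variables (Q : comPzRingType) (T : Type) (e : T -> Q).

Definition generated_ideal : {pred Q^o} := fun x =>
  `[< exists s : seq (T * Q), x = \sum_(p <- s) p.2 * e p.1 >].

Lemma generated_idealP (x : Q) :
  reflect (exists s : seq (T * Q), x = \sum_(p <- s) p.2 * e p.1)
          (x \in generated_ideal).
Proof. exact: asboolP. Qed.

Lemma generated_ideal_submod_closed : submod_closed generated_ideal.
Proof.
split=> [|a x y /generated_idealP[s ->] /generated_idealP[t ->]].
  by apply/generated_idealP; exists [::]; rewrite big_nil.
apply/generated_idealP; exists ([seq (p.1, a * p.2) | p <- s] ++ t).
rewrite big_cat big_map /=; congr (_ + _).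
by rewrite /GRing.scale /= mulr_sumr; apply: eq_bigr => p _; rewrite mulrA.
Qed.

HB.instance Definition _ :=
  GRing.isSubmodClosed.Build Q Q^o generated_ideal generated_ideal_submod_closed.

Lemma mem_generated_ideal i : e i \in generated_ideal.
Proof.
by apply/generated_idealP; exists [:: (i, 1)]; rewrite big_seq1 /= mul1r.
Qed.

Lemma generated_ideal_sub (I : ideal Q) :
  (forall i, e i \in I) -> {subset generated_ideal <= I}.
Proof.
move=> eI x /generated_idealP[s ->]; apply: (@rpred_sum _ I) => p _.
exact: (@rpredZ Q Q^o I p.2 (e p.1) (eI _)).
Qed.

End GeneratedIdeal.

Lemma principal_idealP (Q : comPzRingType) (e x : Q) :
  x \in generated_ideal (fun _ : unit => e) -> exists a, x = a * e.
Proof.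
move=> /generated_idealP[s ->]; exists (\sum_(p <- s) p.2).
by rewrite mulr_suml.
Qed.

Section Gluing.
Variables (Q : comPzRingType) (T : Type) (e y : T -> Q).
Hypothesis ye : forall i, y i * e i = y i.
Hypothesis compat : forall i j, e i * y j = e j * y i.

(** The combination z of the [y i] satisfies z * e j = x * y j = 0 for every j,
    where x is the same combination of the [e i]. So z is fixed by the product
    of the factors [1 - e i] over the indices that occur in it, and this product
    kills each of the [y i] from which z is built. *)
Lemma compatible_sum0 (s : seq (T * Q)) :
  \sum_(p <- s) p.2 * e p.1 = 0 -> \sum_(p <- s) p.2 * y p.1 = 0.
Proof.
move=> x0; pose z (t : seq (T * Q)) := \sum_(p <- t) p.2 * y p.1.
rewrite -/(z s); pose u (t : seq (T * Q)) := \prod_(p <- t) (1 - e p.1).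
have ez j : z s * e j = 0.
  transitivity ((\sum_(p <- s) p.2 * e p.1) * y j); last by rewrite x0 mul0r.
  rewrite /z !mulr_suml; apply: eq_bigr => p _.
  by rewrite -!mulrA [y _ * _]mulrC compat.
have zu t : z s * u t = z s.
  elim: t => [|p t IH]; first by rewrite /u big_nil mulr1.
  by rewrite /u big_cons mulrA mulrBr mulr1 ez subr0.
have zu0 t : z t * u t = 0.
  elim: t => [|p t IH]; first by rewrite /z big_nil mul0r.
  rewrite /z /u !big_cons -/(z t) -/(u t) mulrDl.
  rewrite [z t * _]mulrCA IH mulr0 addr0 mulrA.
  by rewrite -[p.2 * _ * _]mulrA mulrBr mulr1 ye subrr mulr0 mul0r.
by rewrite -(zu s) zu0.
Qed.

Lemma compatible_sum_eq (s t : seq (T * Q)) :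
  \sum_(p <- s) p.2 * e p.1 = \sum_(p <- t) p.2 * e p.1 ->
  \sum_(p <- s) p.2 * y p.1 = \sum_(p <- t) p.2 * y p.1.
Proof.
move=> /eqP; rewrite -subr_eq0 => /eqP st; apply/eqP; rewrite -subr_eq0.
have negE v : - \sum_(p <- t) p.2 * v p.1 =
    \sum_(p <- [seq (p.1, - p.2) | p <- t]) p.2 * v p.1.
  by rewrite big_map -sumrN; apply: eq_bigr => p _ /=; rewrite mulNr.
by rewrite negE -big_cat compatible_sum0// big_cat -negE.
Qed.

(** The homomorphism to extend sends a combination of the [e i] to the same
    combination of the [y i]; [h] is the image of 1 under an extension. *)
Lemma self_injective_glue :
  self_injective Q -> exists h : Q, forall i, h * e i = y i.
Proof.
move=> injQ; pose I : ideal Q := generated_ideal e.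
pose c (x : ideal_module I) := projT1 (cid (generated_idealP _ _ (ideal_valP x))).
have cE x : ideal_val x = \sum_(p <- c x) p.2 * e p.1.
  by rewrite /c; case: cid.
pose f x : Q^o := \sum_(p <- c x) p.2 * y p.1.
have fE x (s : seq (T * Q)) :
    ideal_val x = \sum_(p <- s) p.2 * e p.1 -> f x = \sum_(p <- s) p.2 * y p.1.
  by rewrite cE; exact: compatible_sum_eq.
have f_lin : linear f.
  move=> a x z.
  rewrite (fE _ ([seq (p.1, a * p.2) | p <- c x] ++ c z)).
    rewrite big_cat big_map; congr (_ + _).
    by rewrite /GRing.scale /= mulr_sumr; apply: eq_bigr => p _; rewrite mulrA.
  have -> : ideal_val (a *: x + z) = a * ideal_val x + ideal_val z by [].
  rewrite big_cat big_map !cE; congr (_ + _).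
  by rewrite mulr_sumr; apply: eq_bigr => p _; rewrite mulrA.
pose F : {linear ideal_module I -> Q^o} :=
  HB.pack f (GRing.isLinear.Build Q _ Q^o _ f f_lin).
have [g gE] := injQ I F.
exists (g 1) => i.
have := gE (IdealModule (mem_generated_ideal e i)).
rewrite /= (fE _ [:: (i, 1)]) ?big_seq1 ?mul1r// => <-.
have : g (e i *: (1 : Q^o)) = e i *: g 1 by rewrite linearZ.
by rewrite /GRing.scale /= mulr1 mulrC.
Qed.

End Gluing.

(** * The socle of the ring of measurable functions *)

Section SocleOfMeasurableFunctions.
Variables (R : realType) (d : measure_display) (X : measurableType d).
Local Notation M := {mfun X >-> R}.
Local Notation atom := (field_atom (@measurable d X)).
Implicit Types (f g : M) (A B C : set X).

Definition cozero f : set X := [set x | f x != 0].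

Lemma measurable_level f (r : R) : measurable (f @^-1` [set r]).
Proof. by rewrite -[_ @^-1` _]setTI; apply: measurable_funPT. Qed.

Lemma measurable_cozero f : measurable (cozero f).
Proof.
have -> : cozero f = ~` (f @^-1` [set 0]).
  by apply/seteqP; split => x /= /eqP.
by apply: measurableC; exact: measurable_level.
Qed.

Lemma mfunME f g x : (f * g) x = f x * g x.
Proof. by []. Qed.

(** The lock keeps unification from unfolding indicators into products when
    rewriting with [mfunME]. *)
Definition chi A (mA : measurable A) : M := locked (indic_mfun A mA).

Lemma chiE A (mA : measurable A) x :
  chi mA x = (x \in A)%:R.
Proof. by rewrite /chi -lock /indic_mfun mindicE. Qed.

(** Inversion, with its convention 0^-1 = 0, is continuous off 0. *)
Lemma measurable_funV : measurable_fun [set: R] (@GRing.inv R).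
Proof.
have -> : [set: R] = [set 0] `|` ~` [set 0] by rewrite setUv.
have mN0 : measurable (~` [set 0 : R]) by apply: measurableC.
apply/measurable_funU => //; split; first exact: measurable_fun_set1.
have oN0 : open (~` [set 0 : R]) by apply: closed_openC; exact: closed_eq.
apply: subspace_continuous_measurable_fun => //.
rewrite continuous_open_subspace// => x; rewrite inE /= => /eqP x0.
exact: inv_continuous.
Qed.

(** M is von Neumann regular: [f * g] is the indicator of the cozero set. *)
Lemma quasi_inverse f : exists g : M, forall x, g x = (f x)^-1.
Proof.
have mfV : measurable_fun setT (@GRing.inv R \o f).
  by apply: measurableT_comp => //; exact: measurable_funV.
by exists (mfun_Sub (mem_set mfV)).
Qed.

Lemma atom_constant B f x y : atom B -> B x -> B y -> f x = f y.
Proof.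
move=> [mB _ minB] Bx By.
have BfxE : B `&` f @^-1` [set f x] = B.
  apply: minB => [||z []//]; last by exists x.
  by apply: measurableI => //; exact: measurable_level.
by move: By; rewrite -BfxE => -[_ /= ->].
Qed.

(** If C is a nonempty measurable part of the cozero set, minimality makes [f] a
    multiple of [f * chi C], so [f] vanishes off C. *)
Lemma minimal_ideal_cozero_atom (I : ideal M) f :
  minimal_ideal I -> f \in I -> f != 0 -> atom (cozero f).
Proof.
move=> [_ minI] fI f0; split; first exact: measurable_cozero.
  apply: contrapT => fN0; move/eqP: f0; apply; apply/mfuneqP => x.
  by apply/eqP; apply: contrapT => fx0; apply: fN0; exists x; exact/negP.
move=> C mC [c Cc] Cf.
pose J : ideal M := generated_ideal (fun _ : unit => f * chi mC).
have fJ : f \in J.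
  rewrite minI//.
    exists (f * chi mC); first exact: (@mem_generated_ideal _ _ _ tt).
    apply/eqP => /mfuneqP /(_ c); rewrite mfunME chiE mem_set// mulr1.
    by apply/eqP/Cf.
  apply: generated_ideal_sub => _; rewrite mulrC.
  exact: (@rpredZ M M^o I (chi mC) f fI).
apply/seteqP; split=> // x; rewrite /cozero /=.
have [a ->] := principal_idealP fJ; rewrite 2!mfunME chiE.
case: (boolP (x \in C)) => [/set_mem //|_].
by rewrite !mulr0 eqxx.
Qed.

(** Functions are constant on an atom, so this ideal is a copy of the field of
    real numbers. *)
Lemma atom_ideal_minimal B (aB : atom B) (mB : measurable B) :
  minimal_ideal (generated_ideal (fun _ : unit => chi mB) : ideal M).
Proof.
have [_ [b Bb] _] := aB; split.
  exists (chi mB); first exact: (@mem_generated_ideal _ _ _ tt).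
  by apply/eqP => /mfuneqP /(_ b) /eqP; rewrite chiE mem_set// oner_eq0.
move=> J [f fJ f0] JB f'; apply/idP/idP => [|f'B]; first exact: JB.
have [a fE] := principal_idealP (JB _ fJ).
have [a' ->] := principal_idealP f'B.
have ab0 : a b != 0.
  apply: contra_neq f0 => ab0; apply/mfuneqP => x; rewrite fE mfunME chiE.
  case: (boolP (x \in B)) => [/set_mem Bx|_]; last by rewrite mulr0.
  by rewrite (atom_constant a aB Bx Bb) ab0 mul0r.
have [g gE] := quasi_inverse a.
suff -> : a' * chi mB = (a' * g) * f by exact: (@rpredZ M M^o J (a' * g) f fJ).
apply/mfuneqP => x; rewrite fE 4!mfunME chiE gE.
case: (boolP (x \in B)) => [/set_mem Bx|_]; last by rewrite !mulr0.
by rewrite !mulr1 mulfVK// (atom_constant a aB Bx Bb).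
Qed.

Lemma socle_cozeroP f :
  f \in socle M <->
  exists2 s : seq (set X), (forall B, B \in s -> atom B) &
    forall x, f x != 0 -> exists2 B, B \in s & B x.
Proof.
split=> [/asboolP[s sP ->]|[s]].
  exists [seq cozero g | g <- s & g != 0].
    move=> _ /mapP[g + ->]; rewrite mem_filter => /andP[g0 /sP[I Imin gI]].
    exact: minimal_ideal_cozero_atom Imin gI g0.
  move=> x; apply: contra_neqP => xN; rewrite mfun_sum big1_seq// => g /= gs.
  apply: contrapT => /eqP gx0; apply: xN; exists (cozero g) => //.
  apply: map_f; rewrite mem_filter gs andbT.
  by apply: contra_neq gx0 => ->.
(* Peel the atoms off one at a time: f = f * chi B + f * (1 - chi B). *)
elim: s f => [|B s IH] f sP fs.
  suff -> : f = 0 by exact: rpred0.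
  by apply/mfuneqP => x; apply/eqP; apply: contrapT => /negP /fs[].
have aB : atom B by apply: sP; rewrite mem_head.
have [mB _ _] := aB.
have -> : f = f * chi mB + f * (1 - chi mB).
  by rewrite -mulrDr addrC subrK mulr1.
apply: rpredD.
  apply/asboolP; exists [:: f * chi mB]; last by rewrite big_seq1.
  move=> g; rewrite mem_seq1 => /eqP ->.
  exists (generated_ideal (fun _ : unit => chi mB) : ideal M).
    exact: atom_ideal_minimal.
  exact: (@rpredZ M M^o _ f (chi mB) (@mem_generated_ideal _ _ _ tt)).
apply: IH => [C Cs|x]; first by apply: sP; rewrite inE Cs orbT.
rewrite mfunME mfunB /= chiE.
case: (boolP (x \in B)) => [_|/negP BNx]; first by rewrite subrr mulr0 eqxx.
rewrite subr0 mulr1 => /fs[C]; rewrite inE => /orP[/eqP -> Bx|Cs Cx].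
  by exfalso; apply: BNx; exact/mem_set.
by exists C.
Qed.

End SocleOfMeasurableFunctions.

(** * The quotient by the socle *)

Section QuotientBySocle.
Variables (R : realType) (d : measure_display) (X : measurableType d).
Local Notation M := {mfun X >-> R}.
Local Notation atom := (field_atom (@measurable d X)).
Local Notation Q := (ideal_quotient (socle M)).
Local Notation chi := (@chi R d X _).
Implicit Types (f g : M) (A B C : set X).

Definition proj f : Q := \pi_Q%qT f.

Lemma proj_surj (q : Q) : exists f, proj f = q.
Proof. by exists (repr q); rewrite /proj reprK. Qed.

Lemma projM f g : proj (f * g) = proj f * proj g.
Proof. by rewrite /proj -quotient_mul_pi. Qed.

Lemma proj0 : proj 0 = 0.
Proof. by rewrite /proj piE. Qed.

Lemma projP f g :
  proj f = proj g <->
  exists2 s : seq (set X), (forall B, B \in s -> atom B) &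
    forall x, f x != g x -> exists2 B, B \in s & B x.
Proof.
rewrite /proj ideal_quotient_piP socle_cozeroP.
by split=> -[s sP fg]; exists s => // x; have := fg x;
  rewrite mfunB /= subr_eq0.
Qed.

Lemma chiM A (mA : measurable A) : chi mA * chi mA = chi mA.
Proof.
apply/mfuneqP => x; rewrite mfunME chiE.
by case: (x \in A); rewrite ?mulr1 ?mulr0.
Qed.

Lemma atoms_meet A B x : atom A -> atom B -> A x -> B x -> A = B.
Proof.
move=> [mA _ minA] [mB _ minB] Ax Bx.
have mAB : measurable (A `&` B) by exact: measurableI.
have AB0 : A `&` B !=set0 by exists x.
by rewrite -(minA _ mAB AB0)//; apply: minB => // z [].
Qed.

End QuotientBySocle.

(** * Finiteness of the set of atoms *)

Definition prefix_code (a : nat -> bool) (n : nat) : nat :=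
  choice.pickle (mkseq a n).

(** Hence the sets of codes of the prefixes of [a], as [a] varies, are infinite and
    pairwise almost disjoint: two distinct sequences share only the prefixes
    that do not reach their first point of disagreement. *)
Lemma prefix_code_inj a b m n : prefix_code a m = prefix_code b n ->
  m = n /\ forall i, (i < m)%N -> a i = b i.
Proof.
move=> /(pcan_inj choice.pickleK) ab.
have mn : m = n by rewrite -(size_mkseq a m) ab size_mkseq.
split=> // i im; rewrite -(nth_mkseq false a im) ab nth_mkseq//.
by rewrite -mn.
Qed.

Section FinitelyManyAtoms.
Variables (R : realType) (d : measure_display) (X : measurableType d).
Local Notation M := {mfun X >-> R}.
Local Notation atom := (field_atom (@measurable d X)).
Local Notation Q := (ideal_quotient (socle M)).
Local Notation chi := (@chi R d X _).

(** [E a] is the union of the atoms numbered by the prefixes of [a]; by almost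
    disjointness the [E a] are orthogonal in Q. Cantor's diagonal enters in the
    prescribed value [c a]: it is 1 exactly when [a], seen as a set of
    numbers, contains finitely many of the codes of its own prefixes, so a
    function [g] cannot equal [c a] on almost all atoms of [E a] when [a] encodes
    the set of atoms where [g] takes the value 1. *)
Lemma self_injective_no_atom_sequence (b : nat -> set X) :
  self_injective Q -> injective b -> ~ (forall n, atom (b n)).
Proof.
move=> injQ b_inj ab.
have b_eq k l x : b k x -> b l x -> k = l.
  by move=> bk bl; apply: b_inj; apply: atoms_meet bk bl.
pose E (a : nat -> bool) := \bigcup_n b (prefix_code a n).
have mE a : measurable (E a).
  by apply: bigcupT_measurable => n; have [] := ab (prefix_code a n).
pose c (a : nat -> bool) : bool :=
  `[< finite_set [set n | a (prefix_code a n)] >].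
pose e a : Q := proj (chi (mE a)).
pose y a : Q := proj (chi (mE a) *+ c a).
have ye a : y a * e a = y a.
  by rewrite /y /e -projM mulrnAl chiM.
have compat a a' : e a * y a' = e a' * y a.
  have [<- //|aa'] := pselect (a = a').
  rewrite /y /e -!projM; apply/projP.
  have [i aa'i] : exists i, a i != a' i.
    apply: contrapT => aa'N; apply: aa'; apply/funext => i.
    by apply/eqP; apply: contrapT => /negP aa'i; apply: aa'N; exists i.
  exists [seq b (prefix_code a n) | n <- iota 0 i.+1] => [B /mapP[n _ ->] //|x].
  rewrite !mfunME !mfunMn !chiE.
  case: (boolP (x \in E a)); last by rewrite mul0r mul0rn mulr0 eqxx.
  case: (boolP (x \in E a')); last by rewrite mul0r mul0rn mulr0 eqxx.
  move=> /set_mem[m _ xm] /set_mem[n _ xn] _.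
  have [nm aa'E] := prefix_code_inj (b_eq _ _ _ xn xm).
  exists (b (prefix_code a n)) => //; apply: map_f.
  rewrite mem_iota add0n ltnS /= leqNgt; apply/negP => lt_in.
  by move/eqP: aa'i; apply; exact: aa'E.
have [q qe] := self_injective_glue ye compat injQ.
have [g gq] := proj_surj q.
pose a k : bool := `[< exists2 x, b k x & g x = 1 >].
have := qe a; rewrite -gq /e /y -projM => /projP[s sP gs].
(* An atom of [E a] with a point where [g] differs from [c a] meets an atom of
   [s], so it is that atom. *)
have gc n : b (prefix_code a n) \in s \/
    forall x, b (prefix_code a n) x -> g x = (c a)%:R.
  have [?|nNs] := boolP (b (prefix_code a n) \in s); first by left.
  right=> x xn; apply/eqP; apply: contrapT => /negP gx.
  have xE : x \in E a by apply/mem_set; exists n.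
  have [|B Bs Bx] := gs x.
    by rewrite mfunME mfunMn chiE xE mulr1.
  by move/negP: nNs; apply; rewrite (atoms_meet (ab _) (sP _ Bs) xn Bx).
have fins : finite_set [set n | b (prefix_code a n) \in s].
  apply: (@finite_preimage _ _ [set` s] (b \o prefix_code a)) => //.
  by move=> m n _ _ /b_inj /prefix_code_inj[].
(* If [c a] is 1, then [a] holds at almost all of the prefixes of [a]; if it is
   0, then [a] holds only at those whose atom is in [s]. *)
have [ca|ca] := boolP (c a).
  apply: infinite_nat.
  apply: (@sub_finite_set _ _ ([set n | b (prefix_code a n) \in s] `|`
      [set n | a (prefix_code a n)])).
    move=> n _; have [|gn] := gc n; [by left|right].
    have [_ [x bx] _] := ab (prefix_code a n).
    by apply/asboolP; exists x => //; rewrite gn// ca.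
  by rewrite finite_setU; split => //; exact/asboolP.
move/negP: (ca); apply; apply/asboolP; apply: sub_finite_set fins => n.
move=> /asboolP[x xn gx]; have [//|gn] := gc n.
by move/eqP: gx; rewrite gn// (negbTE ca) eq_sym oner_eq0.
Qed.

Lemma self_injective_finite_atoms :
  self_injective Q -> finite_set [set A : set X | atom A].
Proof.
move=> injQ; apply: contrapT => /infiniteP /pcard_leP[b].
apply: (self_injective_no_atom_sequence injQ (b := b)).
  by move=> m n bmn; apply: (@inj _ _ setT b) => //; exact: mem_set.
by move=> n; exact: (@funS _ _ _ _ b n).
Qed.

End FinitelyManyAtoms.

(** * Completeness *)

Section Completeness.
Variables (R : realType) (d : measure_display) (X : measurableType d).
Local Notation M := {mfun X >-> R}.
Local Notation atom := (field_atom (@measurable d X)).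
Local Notation Q := (ideal_quotient (socle M)).
Local Notation chi := (@chi R d X _).

Definition atomic_part : set X := \bigcup_(A in [set A | atom A]) A.

Lemma proj_eq_off_atoms (f g : M) x :
  proj f = proj g -> ~ atomic_part x -> f x = g x.
Proof.
move=> /projP[s sP fg] xN; apply/eqP; apply: contrapT => /negP /fg[B Bs Bx].
by apply: xN; exists B => //; exact: sP.
Qed.

Hypothesis fin_atoms : finite_set [set A : set X | atom A].

Lemma eq_off_atoms_proj (f g : M) :
  (forall x, ~ atomic_part x -> f x = g x) -> proj f = proj g.
Proof.
move=> fg; have [s sE] := (finite_seqP _).1 fin_atoms.
have sP B : B \in s <-> atom B.
  by split=> [Bs|aB]; [have : [set` s] B by []; rewrite -sE|
                       have : [set A | atom A] B by []; rewrite sE].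
apply/projP; exists s => [B /sP //|x fgx].
have [[B aB Bx]|/fg fgE] := pselect (atomic_part x).
  by exists B => //; exact/sP.
by move: fgx; rewrite fgE eqxx.
Qed.

Lemma measurable_union_of_atoms (P : set (set X)) :
  measurable (\bigcup_(A in [set A | atom A] `&` P) A).
Proof.
apply: fin_bigcup_measurable => [|A [[]]//].
by apply: sub_finite_set fin_atoms => A [].
Qed.

Lemma measurable_atomic_part : measurable atomic_part.
Proof. by apply: fin_bigcup_measurable => // A []. Qed.

(** Glue the value 1 on the members of [F] with the value 0 on the measurable
    sets disjoint from all of them. Off the atoms the resulting [g] is 1 on
    every member of [F], and 0 off every measurable upper bound of [F]. Classes
    in Q ignore the atoms, so the atoms contained in a member of [F] are added
    separately. *)
Lemma self_injective_complete :
  self_injective Q -> complete_field (@measurable d X).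
Proof.
move=> injQ F mF _.
pose T := {C : set X | measurable C /\
  (F C \/ forall B, F B -> B `&` C = set0)}.
pose mT (i : T) : measurable (sval i) := (svalP i).1.
pose e (i : T) : Q := proj (chi (mT i)).
pose y (i : T) : Q := e i *+ `[< F (sval i) >].
have ee i : e i * e i = e i by rewrite /e -projM chiM.
have ye i : y i * e i = y i by rewrite /y mulrnAl ee.
have e_disj i j : sval i `&` sval j = set0 -> e i * e j = 0.
  move=> ij0; rewrite -(@proj0 R d X).
  rewrite /e -projM; congr (proj _); apply/mfuneqP => x.
  rewrite !mfunME !chiE mfun0 /=.
  case: (boolP (x \in sval i)) => [/set_mem xi|]; last by rewrite mul0r.
  case: (boolP (x \in sval j)) => [/set_mem xj|]; last by rewrite mulr0.
  by have : (sval i `&` sval j) x by []; rewrite ij0.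
have compat i j : e i * y j = e j * y i.
  rewrite /y !mulrnAr.
  case: (asboolP (F (sval i))) => Fi; case: (asboolP (F (sval j))) => Fj //=.
  - by rewrite mulrC.
  - rewrite mulr0n mulr1n e_disj//; have [_ [//|jF]] := svalP j.
    by rewrite setIC; exact: jF.
  - rewrite mulr0n mulr1n e_disj//; have [_ [//|iF]] := svalP i.
    by rewrite setIC; exact: iF.
have [q qe] := self_injective_glue ye compat injQ.
have [g gq] := proj_surj q.
have gE (i : T) x : sval i x -> ~ atomic_part x -> g x = `[< F (sval i) >]%:R.
  move=> ix /(@proj_eq_off_atoms (g * chi (mT i))
    (chi (mT i) *+ `[< F (sval i) >])).
  rewrite mfunME mfunMn chiE mem_set// mulr1 => -> //.
  rewrite projM gq; have := qe i; rewrite /y /e => ->.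
  by case: `[< _ >]; rewrite ?mulr1n ?mulr0n ?proj0.
pose P : set (set X) := [set A | exists2 B, F B & A `<=` B].
exists ((g @^-1` [set 1] `\` atomic_part) `|`
         \bigcup_(A in [set A | atom A] `&` P) A); split.
- apply: measurableU; last exact: measurable_union_of_atoms.
  apply: measurableD; last exact: measurable_atomic_part.
  exact: measurable_level.
- move=> B FB x Bx; have mB := mF _ FB.
  have [[A aA Ax]|xN] := pselect (atomic_part x).
    right; exists A => //; split=> //; exists B => //.
    have [mA _ minA] := aA.
    have <- : A `&` B = A.
      by apply: minA => [||z []//]; [exact: measurableI|exists x].
    by move=> z [].
  left; split=> //=; rewrite (gE (exist _ B (conj mB (or_introl FB))))//=.
  by rewrite asboolT.
- move=> S mS FS x [[/= gx xN]|[A [_ [B FB AB]] Ax]]; last first.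
    by apply: (FS B FB); exact: AB.
  apply: contrapT => xS.
  have SF : forall B, F B -> B `&` ~` S = set0.
    by move=> B FB; apply/seteqP; split=> // z [/(FS _ FB)].
  have := gE (exist _ (~` S) (conj (measurableC mS) (or_intror SF))) x xS xN.
  rewrite gx /=; case: asboolP => [FS'|_ /eqP]; last by rewrite mulr0n oner_eq0.
  by move=> _; exact: xS (FS _ FS' x xS).
Qed.

End Completeness.

(** * Additivity up to the continuum *)

Lemma well_founded_total_relation (T : eqType) :
  exists2 lt : T -> T -> Prop, well_founded lt &
    forall x y, [\/ x = y, lt x y | lt y x].
Proof.
have [r wo_r] := wochoice.well_ordering_principle T.
have r_total x y : r x y || r y x.
  have [|z [[zA zmin] _]] := wo_r (pred2 x y).
    by exists x; rewrite inE eqxx.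
  have [xz yz] : r z x /\ r z y.
    by split; apply: zmin; rewrite inE eqxx ?orbT.
  by move: zA; rewrite inE => /orP[] /eqP zE; apply/orP;
    [left|right]; rewrite -zE.
have r_anti x y : r x y -> r y x -> x = y.
  move=> rxy ryx; have [|z [_ zuniq]] := wo_r (pred2 x y).
    by exists x; rewrite inE eqxx.
  have rxx t : r t t by have := r_total t t; rewrite orbb.
  rewrite -(zuniq x) ?(zuniq y)//; split; rewrite ?inE ?eqxx ?orbT// => t;
    by rewrite inE => /orP[] /eqP ->.
exists (fun x y => r x y /\ x <> y); last first.
  move=> x y; have [->|/eqP xy] := eqVneq x y; first by constructor 1.
  have /orP[rxy|ryx] := r_total x y; first by constructor 2.
  by constructor 3; split=> // /esym.
move=> x; apply: contrapT => xN.
have [|z [[zN zmin] _]] := wo_r (fun y =>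
    `[< ~ Acc (fun x y => r x y /\ x <> y) y >]).
  by exists x; apply/asboolP.
move/asboolP: zN; apply; constructor => y [ryz yz].
apply: contrapT => yN; apply: yz; apply: r_anti => //.
by apply: zmin; apply/asboolP.
Qed.

Section Suprema.
Variables (d : measure_display) (X : measurableType d).
Hypothesis complete : complete_field (@measurable d X).

(** Adding the empty set to the family extends completeness to the empty
    family. *)
Lemma complete_sup (F : set (set X)) : F `<=` measurable ->
  {S | [/\ measurable S, (forall B, F B -> B `<=` S)
      & forall T, measurable T -> (forall B, F B -> B `<=` T) -> S `<=` T]}.
Proof.
move=> mF; apply: cid.
have [||S [mS FS minS]] := complete (F := F `|` [set set0]).
- by move=> B [/mF //|->]; exact: measurable0.
- by exists set0; right.
exists S; split=> // [B FB|T mT FT]; first by apply: FS; left.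
by apply: minS => // B [/FT //|->]; exact: sub0set.
Qed.

(** A measurable nonempty part of the supremum [S] meets some [D i], since its
    complement is not an upper bound. This applies to the class [K] of the
    points that agree with [x] on all the [G n]. A set [G n] contains [D i] or is
    disjoint from it according to whether [n] is in the code of [i]. Hence [K]
    meets a single [D i], and [K] minus this [D i] is empty. *)
Lemma disjoint_sup_subset_union (J : Type) (code : J -> set nat)
    (D : J -> set X) (S : set X) :
  injective code -> (forall i, measurable (D i)) ->
  (forall i j x, D i x -> D j x -> i = j) ->
  measurable S ->
  (forall T, measurable T -> (forall i, D i `<=` T) -> S `<=` T) ->
  S `<=` \bigcup_i D i.
Proof.
move=> code_inj mD disjD mS minS x Sx.
have mF n : [set B | exists2 i, code i n & B = D i] `<=` measurable.
  by move=> B [i _ ->].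
pose G n := sval (complete_sup (mF n)).
have GP n i z : D i z -> (G n z <-> code i n).
  rewrite /G; case: complete_sup => /= s [ms Fs mins] Diz; split; last first.
    by move=> cin; apply: (Fs (D i)) => //; exists i.
  move=> sz; apply: contrapT => Ncin.
  have /mins : measurable (~` D i) by exact: measurableC.
  apply; last exact: Diz; last exact: sz.
  by move=> B [j cj ->] w Djw Diw; apply: Ncin; rewrite (disjD _ _ _ Diw Djw).
have mG n : measurable (G n) by rewrite /G; case: complete_sup => ? [].
pose K := S `&` \bigcap_n [set z | G n z <-> G n x].
have mK : measurable K.
  apply: measurableI => //; apply: bigcapT_measurable => n.
  have [Gx|NGx] := pselect (G n x).
    rewrite (_ : [set _ | _] = G n)//; apply/seteqP; split=> z /=; tauto.
  rewrite (_ : [set _ | _] = ~` G n); first exact: measurableC.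
  by apply/seteqP; split=> z /=; tauto.
have Kx : K x by split.
have meets C : measurable C -> C `<=` S -> C !=set0 -> exists i z, D i z /\ C z.
  move=> mC CS [c Cc]; apply: contrapT => CN.
  have /minS : measurable (~` C) by exact: measurableC.
  apply; last exact: Cc; last exact: CS.
  by move=> i z Dz Cz; apply: CN; exists i, z.
have KD i z : D i z -> K z -> code i = [set n | G n x].
  move=> Dz [_ Kz]; apply/seteqP; split=> n /=;
  by have := Kz n I; have := GP n i z Dz; rewrite /=; tauto.
have [i [z [Dz Kz]]] := meets K mK (@subIsetl _ _ _) (ex_intro _ x Kx).
exists i => //; apply: contrapT => NDx.
have [||| j [w [Djw [Kw Diw]]]] := meets (K `\` D i).
- exact: measurableD.
- by move=> w [[]].
- by exists x.
apply: Diw; suff -> : i = j by [].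
by apply: code_inj; rewrite (KD _ _ Dz Kz) (KD _ _ Djw Kw).
Qed.

(** [D i] removes from [B i] the supremum [P i] of the earlier members. Suprema
    need not be unions, so [D i] may be smaller than the set of points not met
    before, but the [B i] and the [D i] have the same upper bounds, by induction
    along the well-order. The union of the [D i] is their supremum by
    [disjoint_sup_subset_union], and the union of the [B i] lies in between. *)
Lemma complete_continuum_additive : continuum_succ_additive (@measurable d X).
Proof.
move=> J B /pcard_injP[code code_inj] mB.
have {}code_inj : injective code by move=> i j; apply: code_inj; exact: mem_set.
have [lt lt_wf lt_total] := well_founded_total_relation (set nat).
have mF i : [set C | exists2 j, lt (code j) (code i) & C = B j] `<=` measurable.
  by move=> C [j _ ->].
pose P i := sval (complete_sup (mF i)).
have mP i : measurable (P i) by rewrite /P; case: complete_sup => ? [].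
have BP i j : lt (code j) (code i) -> B j `<=` P i.
  by move=> ji; rewrite /P; case: complete_sup => /= S [_ FS _];
    apply: FS; exists j.
have P_min i T : measurable T ->
    (forall j, lt (code j) (code i) -> B j `<=` T) -> P i `<=` T.
  move=> mT BT; rewrite /P; case: complete_sup => /= S [_ _];
    apply=> // C [j ji ->].
  exact: BT.
pose D i := B i `\` P i.
have mD i : measurable (D i) by exact: measurableD.
have mrD : range D `<=` measurable by move=> C [i _ <-].
have [S [mS DS minS]] := complete_sup mrD.
have BS i : B i `<=` S.
  move: {2}(code i) (erefl (code i)) => u; elim/(well_founded_ind lt_wf): u i.
  move=> u IH i iu x Bx; have [Px|NPx] := pselect (P i x).
    by apply: (P_min i S mS) Px => j ji; apply: (IH (code j)) => //;
      rewrite -iu.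
  by apply: (DS (D i)) => //; exists i.
suff -> : \bigcup_i B i = S by [].
apply/seteqP; split=> [x [i _ /BS]//|x Sx].
have [||i _ [Bx _]] :=
  @disjoint_sup_subset_union J code D S code_inj mD _ mS _ x Sx.
- move=> i j z [Biz NPi] [Bjz NPj].
  have [/code_inj //|ij|ji] := lt_total (code i) (code j).
    by exfalso; apply: NPj; exact: (BP j i).
  by exfalso; apply: NPi; exact: (BP i j).
- by move=> T mT DT; apply: minS => // C [i _ <-].
by exists i.
Qed.

End Suprema.

(** * Self-injectivity *)

Section SelfInjectivity.
Variables (R : realType) (d : measure_display) (X : measurableType d).
Local Notation M := {mfun X >-> R}.
Local Notation atom := (field_atom (@measurable d X)).
Local Notation Q := (ideal_quotient (socle M)).
Local Notation chi := (@chi R d X _).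
Hypothesis complete : complete_field (@measurable d X).

(** For rational r, let [F r] be the supremum of the sets where [f i < r] in
    [D i]. By compatibility, [F r] cuts [D i] in the set where [f i < r], hence
    on [D i] the function [f i] is the infimum of the r such that [x] is in
    [F r]. Elsewhere this infimum may be infinite, and [fine] replaces it by
    0. *)
Lemma complete_glue (J : Type) (D : J -> set X) (f : J -> M) :
  (forall i, measurable (D i)) ->
  (forall i j x, D i x -> D j x -> f i x = f j x) ->
  exists g : M, forall i x, D i x -> g x = f i x.
Proof.
move=> mD ff.
have mlt i (r : rat) : measurable (D i `&` f i @^-1` `]-oo, ratr r[).
  apply: measurableI => //; rewrite -[_ @^-1` _]setTI.
  by apply: measurable_funPT => //; exact: measurable_itv.
have mF r : range (fun i => D i `&` f i @^-1` `]-oo, ratr r[) `<=` measurable.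
  by move=> C [i _ <-].
pose F r := sval (complete_sup complete (mF r)).
have measF r : measurable (F r) by rewrite /F; case: complete_sup => ? [].
have FE i x r : D i x -> (F r x <-> f i x < ratr r).
  rewrite /F; case: complete_sup => /= S [_ FS minS] Dix; split; last first.
    move=> fr; apply: (FS _ (ex_intro2 _ _ i Logic.I erefl)); split=> //=.
  move=> Sx; have : (~` D i `|` (D i `&` f i @^-1` `]-oo, ratr r[)) x.
    apply: minS Sx; first by apply: measurableU => //; exact: measurableC.
    move=> C [j _ <-] z [Djz /=]; rewrite in_itv /= => fjr.
    have [Diz|] := pselect (D i z); last by left.
    by right; split=> //=; rewrite in_itv /= (ff i j z).
  by case=> [//|[_ /=]]; rewrite in_itv.
pose u (n : nat) (x : X) : \bar R :=
  if choice.unpickle n is Some r then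
    if x \in F r then (ratr r)%:E else +oo%E
  else +oo%E.
have mu n : measurable_fun setT (u n).
  rewrite /u; case: choice.unpickle => [r|]; last exact: measurable_cst.
  apply: measurable_fun_ifT => //.
  apply: (measurable_fun_bool true).
  rewrite setTI (_ : _ @^-1` _ = F r)//.
  by apply/seteqP; split=> z /=; [move/set_mem|move/mem_set].
have mg : measurable_fun setT (fun x => fine (einfs (u^~ x) 0%N)).
  by apply: measurableT_comp => //; exact: measurable_fun_einfs.
exists (mfun_Sub (mem_set mg)) => i x Dix /=.
suff -> : einfs (u^~ x) 0%N = (f i x)%:E by [].
apply/eqP; rewrite eq_le; apply/andP; split.
  apply/lee_addgt0Pr => e e0.
  have [r /[!in_itv] /= /andP[fr rfe]] :=
    rat_in_itvoo (ltr_pwDr e0 (lexx (f i x))).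
  apply: (@le_trans _ _ (ratr r)%:E); last by rewrite lee_fin ltW.
  apply: ereal_inf_lbound => /=; exists (choice.pickle r) => //.
  by rewrite /u choice.pickleK mem_set//; exact/(FE i).
apply: le_ereal_inf_tmp => _ [n _ <-]; rewrite /u.
case: choice.unpickle => [r|]; last exact: leey.
case: ifPn => [/set_mem Fx|_]; last exact: leey.
by rewrite lee_fin ltW//; exact/(FE i).
Qed.

Hypothesis fin_atoms : finite_set [set A : set X | atom A].
Local Notation U := (@atomic_part d X).

(** The sets [C] in [J] are those off the atoms whose indicator lies in the
    ideal, and [f i] represents the image of the indicator. For [val x]
    represented by [k], the cozero set of [k] off the atoms is one of these sets
    by regularity, and [x] is [val x] times its indicator. So the value of [phi]
    at [x] is given by [k * f i], which agrees with [k * g] off the atoms. *)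
Lemma complete_self_injective : self_injective Q.
Proof.
move=> I phi.
pose J := {C : set X & {mC : measurable C |
  C `<=` ~` U /\ proj (chi mC) \in (I : {pred Q^o})}}.
pose mJ (i : J) : measurable (projT1 i) := sval (projT2 i).
have JU (i : J) : projT1 i `<=` ~` U by have [] := svalP (projT2 i).
have JI (i : J) : proj (chi (mJ i)) \in (I : {pred Q^o}).
  by have [] := svalP (projT2 i).
pose e (i : J) : ideal_module I := IdealModule (JI i).
have [f fE] := boolp.choice (fun i : J => proj_surj (phi (e i))).
have ff i j x : projT1 i x -> projT1 j x -> f i x = f j x.
  move=> ix jx.
  have : proj (f i * chi (mJ j)) = proj (f j * chi (mJ i)).
    rewrite !projM !fE mulrC [RHS]mulrC.
    have: phi (proj (chi (mJ j)) *: e i) = phi (proj (chi (mJ i)) *: e j).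
      by congr (phi _); apply: val_inj; rewrite /= /GRing.scale /= mulrC.
    by rewrite !linearZ.
  move=> /proj_eq_off_atoms /(_ (JU _ _ ix)).
  by rewrite !mfunME !chiE !mem_set// !mulr1.
have [g gE] := complete_glue mJ ff.
pose m (q : Q^o) : Q^o := q * proj g.
have m_lin : linear m by move=> a q r; rewrite /m /GRing.scale /= mulrDl mulrA.
pose G : {linear Q^o -> Q^o} :=
  HB.pack m (GRing.isLinear.Build Q _ Q^o _ m m_lin).
exists G => x; rewrite /= /m.
have [k kx] := proj_surj (val x).
have [k' k'E] := quasi_inverse k.
have mE : measurable (cozero k `\` U).
  apply: measurableD; first exact: measurable_cozero.
  exact: measurable_atomic_part.
have EI : proj (chi mE) \in (I : {pred Q^o}).
  have -> : proj (chi mE) = proj k' * val x.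
    rewrite -kx -projM; apply: eq_off_atoms_proj => // z zU.
    rewrite mfunME chiE k'E; have [k0|k0] := eqVneq (k z) 0.
      by rewrite k0 mulr0 memNset// => -[/=]; rewrite /cozero /= k0 eqxx.
    by rewrite mulVf// mem_set.
  exact: (@rpredZ Q Q^o I (proj k') (val x) (ideal_valP x)).
pose i : J := existT _ _ (exist _ mE (conj (@subIsetr _ _ _) EI)).
have xE : x = val x *: e i.
  apply: val_inj; rewrite /= /GRing.scale /= -[ideal_val x]kx -projM.
  apply: eq_off_atoms_proj => // z zU; rewrite mfunME chiE.
  have [k0|k0] := eqVneq (k z) 0; first by rewrite k0 mul0r.
  by rewrite mem_set ?mulr1.
have phiE : phi x = proj k * proj (f i).
  by rewrite {1}xE linearZ fE kx.
rewrite phiE -[ideal_val x]kx -!projM.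
apply: eq_off_atoms_proj => // z zU; rewrite !mfunME.
have [k0|k0] := eqVneq (k z) 0; first by rewrite k0 !mul0r.
by rewrite (gE i z).
Qed.

End SelfInjectivity.

(** * The characterization *)

Theorem theorem4p11 (R : realType) (d : measure_display)
    (X : measurableType d) :
  self_injective (ideal_quotient (socle {mfun X >-> R})) <->
  [/\ complete_field (@measurable d X),
      continuum_succ_additive (@measurable d X) &
      finite_set [set A : set X | field_atom (@measurable d X) A]].
Proof.
split=> [injQ|[complete _ fin_atoms]]; last exact: complete_self_injective.
have fin_atoms := self_injective_finite_atoms injQ.
have complete := self_injective_complete fin_atoms injQ.
by split=> //; exact: complete_continuum_additive.
Qed.
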